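(* (1) Let $a$ be a stable natural number. Then there exists $K$ such that for all integers $k\ge K$ and all $\ell\ge 0$, \[\|(a3^k+1)3^\ell\|=\|a\|+3k+3\ell+1.\] (2) Let $a,b$ be natural numbers such that $ab$ is stable and $\|ab\|=\|a\|+\|b\|$. Then there exists $K$ such that for all integers $k\ge K$ and all $\ell\ge 0$, \[\|b(a3^k+1)3^\ell\|=\|a\|+\|b\|+3k+3\ell+1.\] Moreover, in both cases such a $K$ can be computed algorithmically (from $a$, resp. from $a$ and $b$).
   Context: For a natural number $n$, $\|n\|$ denotes its integer complexity: the least number of $1$'s needed to write $n$ using only the constant $1$, addition, multiplication, and parentheses. A natural number $n$ is called stable if $\|3^k n\|=3k+\|n\|$ for every $k\ge 0$. *)

(* Defs.v *)
From mathcomp Require Import all_boot.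
From mathcomp Require Import boolp.
Set Implicit Arguments. Unset Strict Implicit. Unset Printing Implicit Defensive.

Inductive expr : Type :=
| One
| Add of expr & expr
| Mul of expr & expr.

Fixpoint expr_val (e : expr) : nat :=
  match e with
  | One => 1
  | Add e1 e2 => expr_val e1 + expr_val e2
  | Mul e1 e2 => expr_val e1 * expr_val e2
  end.

Fixpoint expr_ones (e : expr) : nat :=
  match e with
  | One => 1
  | Add e1 e2 | Mul e1 e2 => expr_ones e1 + expr_ones e2
  end.

Definition writable (n c : nat) : Prop :=
  exists e : expr, expr_val e = n /\ expr_ones e = c.

Lemma writable_exists (n : nat) : exists c, `[< writable n.+1 c >].
Proof.
suff [e eE] : exists e, expr_val e = n.+1.
  by exists (expr_ones e); apply/asboolP; exists e.
elim: n => [|n [e eE]]; first by exists One.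
by exists (Add e One); rewrite /= eE addn1.
Qed.

(* Zero is the value of no expression; [complexity 0 = 0] is a junk value. *)
Definition complexity (n : nat) : nat :=
  if n is m.+1 then ex_minn (writable_exists m) else 0.

Definition stable (n : nat) : Prop :=
  0 < n /\ forall k : nat, complexity (3 ^ k * n) = 3 * k + complexity n.

(* Kleene's partial recursive functions: [recfun n] is the type of programs
   with [n] inputs. *)
Inductive recfun : nat -> Type :=
| RZero n : recfun n
| RSucc : recfun 1
| RProj n : 'I_n -> recfun n
| RComp n m : recfun m -> ('I_m -> recfun n) -> recfun n
| RPrec n : recfun n -> recfun n.+2 -> recfun n.+1
| RMin n : recfun n.+1 -> recfun n.

(* [computes f v y]: the program [f] halts on input [v] with output [y].  In
   the primitive recursion case [h] lists the successive values
   [h 0], ..., [h (thead v)], and the recursion argument is the first input.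
   Minimization requires [f] to halt on every candidate below the result. *)
Fixpoint computes (n : nat) (f : recfun n) : n.-tuple nat -> nat -> Prop :=
  match f in recfun n return n.-tuple nat -> nat -> Prop with
  | RZero _ => fun _ y => y = 0
  | RSucc => fun v y => y = (thead v).+1
  | RProj _ i => fun v y => y = tnth v i
  | RComp _ m f gs => fun v y =>
      exists2 w : m.-tuple nat,
        forall i, computes (gs i) v (tnth w i) & computes f w y
  | RPrec _ f g => fun v y =>
      exists h : nat -> nat,
        [/\ computes f [tuple of behead v] (h 0),
            forall k, k < thead v ->
              computes g [tuple of k :: h k :: behead v] (h k.+1)
          & y = h (thead v)]
  | RMin _ f => fun v y =>
      computes f [tuple of y :: v] 0 /\
      forall z, z < y -> exists t, computes f [tuple of z :: v] t.+1
  end.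

Lemma computes_functional n (f : recfun n) v y1 y2 :
  computes f v y1 -> computes f v y2 -> y1 = y2.
Proof.
elim: n / f v y1 y2 =>
  [n|||n m f IHf gs IHg|n f IHf g IHg|n f IHf] /= => [v y1 y2 -> -> //|v y1 y2 -> -> //|n i v y1 y2 -> -> //|v y1 y2|v y1 y2|v y1 y2].
- move=> [w1 Hw1 Hf1] [w2 Hw2 Hf2].
  have ww : w1 = w2 by apply: eq_from_tnth => i; apply: IHg (Hw1 i) (Hw2 i).
  by move: Hf1; rewrite ww => Hf1; apply: IHf Hf1 Hf2.
- move=> [h1 [f1 g1 ->]] [h2 [f2 g2 ->]].
  suff H k : k <= thead v -> h1 k = h2 k by apply: H.
  elim: k => [_|k IHk lt_k]; first exact: IHf f1 f2.
  have := g1 _ lt_k; rewrite (IHk (ltnW lt_k)) => Hg.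
  exact: IHg Hg (g2 _ lt_k).
- move=> [f1 lt1] [f2 lt2].
  case: (ltngtP y1 y2) => // [/lt2 | /lt1] [t Ht].
    by have := IHf _ _ _ f1 Ht.
  by have := IHf _ _ _ f2 Ht.
Qed.

(* Main.v *)
(** Let [e] be an expression for [(m 3^k + c) 3^l], with [m] stable, whose number
    of ones is at most [||m|| + 3(k + l)].  Then [3^ones / val^3 <= 3^||m||].
    Deleting every summand that is [R] times smaller than its companion costs at
    least a factor [2] in this ratio, so there are boundedly many deletions, and
    what remains has value [w 3^j] with [w] bounded in terms of [R].  By
    pigeonhole on a sequence of scales, one [R] can be chosen for which every
    deleted summand is in fact smaller by a factor [R'], as large as one likes
    compared with the bound for [w].  If nothing was deleted, then
    [(m 3^k + c) 3^l = w 3^j], which is impossible for large [k].  Otherwise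
    [w 3^j] is so close to [m 3^(k + l)] that the two are equal, so by stability
    what remains still has at least [||m|| + 3(k + l)] ones, and [e] has more.
    The resulting threshold for [k] is an explicit primitive recursive function
    of [m] and [c]; the theorem takes [m = a, c = 1] and [m = a b, c = b]. *)
Require Import Defs.
From mathcomp Require Import all_boot.
From mathcomp Require Import boolp zify ring.
Set Implicit Arguments. Unset Strict Implicit. Unset Printing Implicit Defensive.

(** * Elementary bounds on complexity *)

Lemma expr_val_gt0 e : 0 < expr_val e.
Proof. by elim: e => //= e1 ? e2 ?; rewrite ?muln_gt0 ?addn_gt0; lia. Qed.

Lemma expr_ones_gt0 e : 0 < expr_ones e.
Proof. by elim: e => //= e1 ? e2 ?; rewrite addn_gt0; lia. Qed.

Lemma complexity_expr n : 0 < n ->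
  exists e, expr_val e = n /\ expr_ones e = complexity n.
Proof. by case: n => // n _ /=; case: ex_minnP => c /asboolP. Qed.

Lemma complexity_le e : complexity (expr_val e) <= expr_ones e.
Proof.
case E: (expr_val e) => [|n] //=; case: ex_minnP => c _; apply.
by apply/asboolP; exists e.
Qed.

Lemma complexity_mul x y : 0 < x -> 0 < y ->
  complexity (x * y) <= complexity x + complexity y.
Proof.
move=> /complexity_expr [e [<- <-]] /complexity_expr [f [<- <-]].
exact: complexity_le (Mul e f).
Qed.

Lemma complexity_succ x : 0 < x -> complexity (x + 1) <= complexity x + 1.
Proof. by move=> /complexity_expr [e [<- <-]]; exact: complexity_le (Add e One). Qed.

Lemma complexity_mul_exp3 x k : 0 < x -> complexity (x * 3 ^ k) <= complexity x + 3 * k.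
Proof.
move=> x_gt0; elim: k => [|k IHk]; first by rewrite muln1 addn0.
have le3 : complexity 3 <= 3 by exact: complexity_le (Add One (Add One One)).
rewrite expnSr mulnA.
have := @complexity_mul (x * 3 ^ k) 3; rewrite muln_gt0 x_gt0 expn_gt0; lia.
Qed.

Lemma complexity_le_id n : complexity n <= n.
Proof.
case: n => // n; suff [e [<- {2}<-]] : exists e, expr_val e = n.+1 /\ expr_ones e = n.+1.
  exact: complexity_le.
elim: n => [|n [e [eV eO]]]; first by exists One.
by exists (Add e One); rewrite /= eV eO addn1.
Qed.

(** * The ratio of [3 ^ ones] to the cube of the value *)

(** This is the case of [cube_val_gap] with a summand of value [1]: only [3 = 1 + 2] written with
    three ones escapes the gap. *)
Lemma cube_add_le1 y s t : 0 < y -> 0 < s -> 0 < t -> y ^ 3 <= 3 ^ t ->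
  (1 + y = 3 /\ s + t = 3) \/ 9 * (1 + y) ^ 3 <= 8 * 3 ^ (s + t).
Proof.
move=> y_gt0 s_gt0 t_gt0 le_yt.
have le3s : 3 <= 3 ^ s by rewrite -{1}(expn1 3) leq_exp2l.
have [lt3y|] := ltnP 2 y.
  right; rewrite expnD; apply: (@leq_trans (8 * (3 * y ^ 3))).
    by rewrite !expnS expn0; nia.
  by rewrite leq_mul2l /= leq_mul.
case: y y_gt0 le_yt => [|[|[|//]]] // _ le_yt _.
  right; apply: (@leq_trans (8 * 3 ^ 2)); first by [].
  by rewrite leq_mul2l /= leq_exp2l //; lia.
have t_gt1 : 1 < t by case: t le_yt {t_gt0} => [|[|]].
have [st_gt3|] := ltnP 3 (s + t); last by left; lia.
right; apply: (@leq_trans (8 * 3 ^ 4)); first by [].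
by rewrite leq_mul2l /= leq_exp2l.
Qed.

(* [3 ^ ones / val ^ 3] is [3] to the power of the defect; it is [1] exactly for
   optimal expressions of powers of [3], and otherwise at least [9/8], the value
   attained by [2 = 1 + 1]. *)
Lemma cube_val_gap e :
  (exists j, expr_val e = 3 ^ j /\ expr_ones e = 3 * j) \/
  9 * expr_val e ^ 3 <= 8 * 3 ^ expr_ones e.
Proof.
have weak f : (exists j, expr_val f = 3 ^ j /\ expr_ones f = 3 * j) \/
    9 * expr_val f ^ 3 <= 8 * 3 ^ expr_ones f -> expr_val f ^ 3 <= 3 ^ expr_ones f.
  by case=> [[j [-> ->]]|]; [rewrite -expnM mulnC | lia].
elim: e => [|e IHe f IHf|e IHe f IHf] /=; first by right.
- have := weak _ IHe; have := weak _ IHf.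
  have := expr_val_gt0 e; have := expr_val_gt0 f.
  have := expr_ones_gt0 e; have := expr_ones_gt0 f.
  move: IHe IHf.
  set x := expr_val e; set y := expr_val f; set s := expr_ones e; set t := expr_ones f.
  move=> IHe IHf t_gt0 s_gt0 y_gt0 x_gt0 le_yt le_xs.
  have [x_le1|x_gt1] := leqP x 1.
    have -> : x = 1 by lia.
    case: (cube_add_le1 y_gt0 s_gt0 t_gt0 le_yt) => [[-> ->]|]; last by right.
    by left; exists 1.
  have [y_le1|y_gt1] := leqP y 1.
    have -> : y = 1 by lia.
    rewrite addnC [s + t]addnC.
    case: (cube_add_le1 x_gt0 t_gt0 s_gt0 le_xs) => [[-> ->]|]; last by right.
    by left; exists 1.
  (* For [x, y >= 2], [x + y <= x * y] passes on the gap of either summand. If both are powers of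
     [3], then [x, y >= 3] and [3 * (x + y) <= 2 * (x * y)] creates one. *)
  right; rewrite expnD.
  have le_cube : (x + y) ^ 3 <= x ^ 3 * y ^ 3 by rewrite -expnMn leq_exp2r //; nia.
  case: IHe => [[i [xE sE]]|IHe]; last first.
    have := leq_mul IHe le_yt; lia.
  case: IHf => [[j [yE tE]]|IHf]; last first.
    have := leq_mul le_xs IHf; lia.
  have x_ge3 : 3 <= x by case: i xE {sE} => [|i]; rewrite ?expnS => xE; lia.
  have y_ge3 : 3 <= y by case: j yE {tE} => [|j]; rewrite ?expnS => yE; lia.
  have : (3 * (x + y)) ^ 3 <= (2 * (x * y)) ^ 3 by rewrite leq_exp2r //; nia.
  have := leq_mul le_xs le_yt; rewrite !expnMn; lia.
- have := weak _ IHe; have := weak _ IHf => le_f le_e.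
  rewrite expnD expnMn.
  case: IHe => [[i [-> ->]]|IHe]; last by right; have := leq_mul IHe le_f; lia.
  case: IHf => [[j [-> ->]]|IHf]; last first.
    right; have := IHf; rewrite -!expnM [i * 3]mulnC mulnCA [8 * (_ * _)]mulnCA leq_mul2l.
    by move=> ->; rewrite orbT.
  by left; exists (i + j); rewrite expnD mulnDr.
Qed.

Lemma cube_val_le e : expr_val e ^ 3 <= 3 ^ expr_ones e.
Proof. by case: (cube_val_gap e) => [[j [-> ->]]|]; [rewrite -expnM mulnC | lia]. Qed.

(** * Pruning of small summands *)

(** A sum without a dominant summand is kept whole: [balanced_sum_le] will bound its value, so
    nothing inside it needs pruning. *)
Fixpoint prune R (e : expr) : expr :=
  match e with
  | One => One
  | Add e1 e2 =>
      if expr_val e2 * R <= expr_val e1 then prune R e1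
      else if expr_val e1 * R <= expr_val e2 then prune R e2 else e
  | Mul e1 e2 => Mul (prune R e1) (prune R e2)
  end.

Fixpoint cuts R (e : expr) : nat :=
  match e with
  | One => 0
  | Add e1 e2 =>
      if expr_val e2 * R <= expr_val e1 then (cuts R e1).+1
      else if expr_val e1 * R <= expr_val e2 then (cuts R e2).+1 else 0
  | Mul e1 e2 => cuts R e1 + cuts R e2
  end.

Lemma prune_val_le R e : expr_val (prune R e) <= expr_val e.
Proof.
elim: e => //= e IHe f IHf; last exact: leq_mul.
by case: ifP => _; [lia | case: ifP => _ /=; lia].
Qed.

Lemma prune_ones R e : expr_ones (prune R e) + cuts R e <= expr_ones e.
Proof.
elim: e => //= e IHe f IHf; last by lia.
have := expr_ones_gt0 e; have := expr_ones_gt0 f.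
by case: ifP => _; [lia | case: ifP => _ /=; lia].
Qed.

(** A cut drops at most the fraction [1 / (R + 1)] of a sum, and [(1 - x) * (1 - y) >= 1 - (x + y)]
    adds up the losses across products. Truncated subtraction makes the bound trivial when
    [cuts R e > R]. *)
Lemma prune_val_ge R e :
  expr_val e * (R.+1 - cuts R e) <= R.+1 * expr_val (prune R e).
Proof.
have step u v c p : v * R <= u -> u * (R.+1 - c) <= R.+1 * p ->
    (u + v) * (R.+1 - c.+1) <= R.+1 * p.
  move=> le_vu; apply: leq_trans; have [le_cR|] := leqP c R; last by nia.
  by rewrite subSS -(subnK le_cR) in le_vu *; rewrite addnK subSn; nia.
elim: e => [|e IHe f IHf|e IHe f IHf] /=; first by lia.
- case: ifP => [le_fe|_]; first exact: step.
  case: ifP => [le_ef|_] /=; last by lia.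
  by rewrite addnC; apply: step.
- have [|lt_cR] := leqP R.+1 (cuts R e + cuts R f); first by rewrite -subn_eq0 => /eqP ->; lia.
  rewrite -(leq_pmul2l (ltn0Sn R)).
  apply: leq_trans (_ : (expr_val e * (R.+1 - cuts R e)) *
      (expr_val f * (R.+1 - cuts R f)) <= _); last by have := leq_mul IHe IHf; lia.
  rewrite mulnCA [leqRHS]mulnACA leq_mul2l; apply/orP; right.
  move: lt_cR; move: (cuts R e) (cuts R f) => a b lt_cR.
  have -> : R.+1 - a = b + (R.+1 - (a + b)) by lia.
  have -> : R.+1 - b = a + (R.+1 - (a + b)) by lia.
  have {1}-> : R.+1 = a + b + (R.+1 - (a + b)) by lia.
  by nia.
Qed.

(** A cut removes at least one [1], hence a factor [3] from the power, while the cube of the value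
    shrinks by at most [(9/8)^3 <= 3/2], because [R >= 8]. *)
Lemma prune_defect R e : 8 <= R ->
  2 ^ cuts R e * expr_val e ^ 3 * 3 ^ expr_ones (prune R e)
  <= expr_val (prune R e) ^ 3 * 3 ^ expr_ones e.
Proof.
move=> R_ge8.
have step u v c p s t q : 0 < t -> v * R <= u ->
    2 ^ c * u ^ 3 * 3 ^ q <= p ^ 3 * 3 ^ s ->
    2 ^ c.+1 * (u + v) ^ 3 * 3 ^ q <= p ^ 3 * 3 ^ (s + t).
  move=> t_gt0 le_vu le_c.
  have le3t : 3 <= 3 ^ t by rewrite -{1}(expn1 3) leq_exp2l.
  have le_uv : 2 * (u + v) ^ 3 <= 3 * u ^ 3.
    have : (8 * (u + v)) ^ 3 <= (9 * u) ^ 3 by rewrite leq_exp2r //; nia.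
    by rewrite !expnMn; lia.
  rewrite expnD mulnA; apply: leq_trans (leq_mul le_c le3t).
  have := leq_mul (leqnn (2 ^ c * 3 ^ q)) le_uv; rewrite (expnS 2 c).
  by move: (2 ^ c) (3 ^ q) ((u + v) ^ 3) (u ^ 3) => a b x y; lia.
elim: e => [|e IHe f IHf|e IHe f IHf] /=; first by lia.
- have := expr_ones_gt0 e; have := expr_ones_gt0 f => f_gt0 e_gt0.
  case: ifP => [le_fe|_]; first exact: step.
  case: ifP => [le_ef|_] /=; last by rewrite mul1n.
  by rewrite addnC [expr_ones e + _]addnC; apply: step.
- have := leq_mul IHe IHf; rewrite !expnD !expnMn.
  by congr (_ <= _); ring.
Qed.

(* For [1 < R] the two tests in [prune R] exclude each other. *)
Lemma leq_cuts R R' e : 1 < R -> R <= R' -> cuts R' e <= cuts R e.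
Proof.
move=> R_gt1 le_R; elim: e => //= e IHe f IHf; last by lia.
have := expr_val_gt0 e; have := expr_val_gt0 f.
move: (expr_val e) (expr_val f) => x y y_gt0 x_gt0.
case: ifP => [le_yx'|_]; first by have -> : y * R <= x by nia.
case: ifP => [le_xy'|//]; have -> : (y * R <= x) = false by nia.
by have -> : x * R <= y by nia.
Qed.

(** The cuts at scale [R'] are among those at scale [R], so equal counts mean equal cuts. *)
Lemma eq_prune R R' e : 1 < R -> R <= R' -> cuts R' e = cuts R e -> prune R' e = prune R e.
Proof.
move=> R_gt1 le_R; elim: e => //= e IHe f IHf; last first.
  have := leq_cuts e R_gt1 le_R; have := leq_cuts f R_gt1 le_R => ? ? ?.
  by rewrite IHe ?IHf //; lia.
have := expr_val_gt0 e; have := expr_val_gt0 f.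
move: (expr_val e) (expr_val f) => x y y_gt0 x_gt0.
case: ifP => [le_yx'|_]; first by have -> : y * R <= x by [nia]; case=> /IHe.
case: ifP => [le_xy'|_].
  have -> : (y * R <= x) = false by nia.
  by have -> : x * R <= y by [nia]; case=> /IHf.
by case: ifP => // _; case: ifP.
Qed.

(** The ratio is at most [A] before pruning, falls by a factor [2 ^ cuts R e], and stays at least
    [1] by [cube_val_le]. *)
Lemma cuts_lt A R e : 8 <= R -> 3 ^ expr_ones e <= A * expr_val e ^ 3 -> cuts R e < A.
Proof.
move=> R_ge8 le_A; apply: leq_trans (ltn_expl (cuts R e) (ltnSn 1)) _.
have e_gt0 : 0 < expr_val e ^ 3 by rewrite expn_gt0 expr_val_gt0.
have p_gt0 : 0 < 3 ^ expr_ones (prune R e) by rewrite expn_gt0.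
rewrite -(leq_pmul2r e_gt0) -(leq_pmul2r p_gt0).
apply: leq_trans (prune_defect e R_ge8) _.
by rewrite mulnC leq_mul // cube_val_le.
Qed.

Lemma prune_defect_le A R e : 8 <= R -> 3 ^ expr_ones e <= A * expr_val e ^ 3 ->
  3 ^ expr_ones (prune R e) <= A * expr_val (prune R e) ^ 3.
Proof.
move=> R_ge8 le_A.
have e_gt0 : 0 < expr_val e ^ 3 by rewrite expn_gt0 expr_val_gt0.
rewrite -(leq_pmul2l e_gt0).
apply: leq_trans (_ : 2 ^ cuts R e * expr_val e ^ 3 * 3 ^ expr_ones (prune R e) <= _).
  by rewrite -mulnA leq_pmull ?expn_gt0.
apply: leq_trans (prune_defect e R_ge8) _.
by rewrite mulnC mulnA [_ * A]mulnC leq_mul2r le_A orbT.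
Qed.

(** * The value left by pruning *)

(** Adding is wasteful compared with multiplying: [u^3 * v^3 <= 3^(s + t) <= A * (2 * u)^3] bounds
    [v], and then [u < v * R] bounds [u]. *)
Lemma balanced_sum_le A R u v s t : 0 < A -> 0 < R -> 0 < u -> v <= u ->
  u ^ 3 <= 3 ^ s -> v ^ 3 <= 3 ^ t -> 3 ^ (s + t) <= A * (u + v) ^ 3 ->
  u < v * R -> u + v <= 4 * A * R.
Proof.
move=> A_gt0 R_gt0 u_gt0 le_vu le_us le_vt le_A lt_uvR.
have u3_gt0 : 0 < u ^ 3 by rewrite expn_gt0 u_gt0.
have le_v : v ^ 3 <= A * 8.
  rewrite -(leq_pmul2l u3_gt0); apply: leq_trans (leq_mul le_us le_vt) _.
  rewrite -expnD; apply: leq_trans le_A _.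
  rewrite mulnCA leq_mul2l mulnC -[8]/(2 ^ 3) -expnMn leq_exp2r //.
  by apply/orP; right; lia.
have le_v2A : v <= 2 * A.
  rewrite leqNgt; apply/negP => lt_v.
  have : (2 * A) ^ 3 < v ^ 3 by rewrite ltn_exp2r.
  by rewrite expnMn !expnS expn0; nia.
by nia.
Qed.

(* The pruned expression is a product of boundedly many sums of bounded value
   and of optimally written powers of [3]. *)
Lemma prune_core A R e : 0 < A -> 0 < R ->
  3 ^ expr_ones (prune R e) <= A * expr_val (prune R e) ^ 3 ->
  exists w j c,
    [/\ expr_val (prune R e) = w * 3 ^ j, w <= (4 * A * R) ^ c &
      9 ^ c * expr_val (prune R e) ^ 3 <= 8 ^ c * 3 ^ expr_ones (prune R e)].
Proof.
move=> A_gt0 R_gt0; elim: e => [|e IHe f IHf|e IHe f IHf] /=.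
- by move=> _; exists 1, 0, 0.
- case: ifP => [//|lt_e]; case: ifP => [//|lt_f] /= le_A.
  case: (cube_val_gap (Add e f)) => [[j /= [-> ->]]|/= gap].
    by exists 1, j, 0; split; rewrite ?mul1n // -expnM mulnC.
  exists (expr_val e + expr_val f), 0, 1; split; rewrite ?muln1 // expn1.
  have := cube_val_le e; have := cube_val_le f.
  have := expr_val_gt0 e; have := expr_val_gt0 f => f_gt0 e_gt0 le_f le_e.
  case: (leqP (expr_val f) (expr_val e)) => [le_fe|lt_ef].
    by apply: (balanced_sum_le _ _ _ _ le_e le_f); rewrite // ltnNge lt_e.
  rewrite addnC; apply: (balanced_sum_le _ _ _ _ le_f le_e) => //; first exact: ltnW.
    by rewrite addnC [expr_val f + _]addnC.
  by rewrite ltnNge lt_f.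
- set x := expr_val (prune R e) in IHe *; set y := expr_val (prune R f) in IHf *.
  have x_gt0 : 0 < x ^ 3 by rewrite expn_gt0 expr_val_gt0.
  have y_gt0 : 0 < y ^ 3 by rewrite expn_gt0 expr_val_gt0.
  rewrite expnD expnMn => le_A.
  case: IHe => [|w1 [j1 [c1 [xE le_w1 le_x]]]].
    rewrite -(leq_pmul2r y_gt0) -mulnA; apply: leq_trans le_A.
    by rewrite leq_mul2l cube_val_le orbT.
  case: IHf => [|w2 [j2 [c2 [yE le_w2 le_y]]]].
    rewrite -(leq_pmul2l x_gt0) [leqRHS]mulnCA; apply: leq_trans le_A.
    by rewrite leq_mul2r cube_val_le orbT.
  exists (w1 * w2), (j1 + j2), (c1 + c2); split.
  - by rewrite xE yE expnD mulnACA.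
  - by rewrite expnD leq_mul.
  - by rewrite !expnD mulnACA [leqRHS]mulnACA leq_mul.
Qed.

(** This is Bernoulli's inequality [(9/8)^c >= 1 + c/8]. It limits the number [c] of sums in
    [prune_core], each contributing a factor at least [9/8] to the ratio. *)
Lemma exp_gap_le A c : 9 ^ c <= A * 8 ^ c -> c <= 8 * A.
Proof.
move=> le_A; have bern : 8 ^ c * (8 + c) <= 8 * 9 ^ c.
  by elim: c {le_A} => // c IHc; rewrite !expnS; nia.
have c_gt0 : 0 < 8 ^ c by rewrite expn_gt0.
by rewrite -(leq_pmul2l c_gt0); nia.
Qed.

(** At most [8 * A] non-optimal sums remain, each of value at most [4 * A * R]. *)
Definition core_bound A R := (4 * A * R) ^ (8 * A).

Lemma prune_core_bound A R e : 0 < A -> 8 <= R -> 3 ^ expr_ones e <= A * expr_val e ^ 3 ->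
  exists w j, expr_val (prune R e) = w * 3 ^ j /\ w <= core_bound A R.
Proof.
move=> A_gt0 R_ge8 /(prune_defect_le R_ge8) le_A.
have [|w [j [c [eE le_w le_c]]]] := prune_core A_gt0 _ le_A; first by lia.
exists w, j; split=> //; apply: leq_trans le_w _.
rewrite leq_pexp2l //; first by nia.
apply: exp_gap_le.
have e_gt0 : 0 < expr_val (prune R e) ^ 3 by rewrite expn_gt0 expr_val_gt0.
rewrite -(leq_pmul2r e_gt0); apply: leq_trans le_c _.
by rewrite -mulnA mulnCA leq_mul2l le_A orbT.
Qed.

(** * The sequence of scales *)

(** The start [8] is what [prune_defect] requires. The next scale is at least [A * p.+1] for every
    [p] bounded by [core_bound A R] or by [A], as the comparison of values in
    [complexity_lower_bound] demands. *)
Definition scale A i := iter i (fun R => A * (core_bound A R + A.+1)) 8.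

Lemma leq_core_bound A R : 0 < A -> R <= core_bound A R.
Proof.
case: R => // R A_gt0; apply: (@leq_trans ((4 * A * R.+1) ^ 1)); first by rewrite expn1; nia.
by rewrite leq_pexp2l; nia.
Qed.

Lemma core_bound_mono A R R' : R <= R' -> core_bound A R <= core_bound A R'.
Proof.
case: A => [|A] le_R; first by rewrite /core_bound !muln0.
by rewrite leq_exp2r // leq_mul2l le_R orbT.
Qed.

Lemma leq_scaleS A i : 0 < A -> scale A i <= scale A i.+1.
Proof. by move=> A_gt0; rewrite /= -/(scale A i); have := leq_core_bound (scale A i) A_gt0; nia. Qed.

Lemma scale_mono A i j : 0 < A -> i <= j -> scale A i <= scale A j.
Proof.
move=> A_gt0 /subnK <-; elim: (j - i) => // d IHd.
exact: leq_trans IHd (leq_scaleS _ A_gt0).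
Qed.

Lemma scale_ge8 A i : 0 < A -> 8 <= scale A i.
Proof. by move=> A_gt0; apply: (scale_mono A_gt0 (leq0n i)). Qed.

(* The number of cuts decreases with the scale and is smaller than [A] to begin
   with, so two of the first scales prune in the same way. *)
Lemma stationary_scale A e : 3 ^ expr_ones e <= A * expr_val e ^ 3 ->
  exists2 i, i < A & cuts (scale A i.+1) e = cuts (scale A i) e.
Proof.
move=> le_A; have lt_A := cuts_lt (leqnn 8) le_A; have A_gt0 : 0 < A by lia.
apply: contrapT => no_i.
suff : cuts (scale A A) e + A <= cuts 8 e by lia.
suff : forall i, i <= A -> cuts (scale A i) e + i <= cuts 8 e by apply.
elim=> [_|i IHi lt_iA]; first by rewrite addn0.
have := IHi (ltnW lt_iA); have := leq_cuts e (ltn_trans _ (scale_ge8 i A_gt0)) (leq_scaleS i A_gt0).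
move=> /(_ isT); rewrite leq_eqVlt => /orP [/eqP eq_i|]; first by case: no_i; exists i.
by lia.
Qed.

(** * The lower bound *)

(** It ensures [w * c <= k < 3 ^ k] for the core [w] at any of the first [3 ^ m] scales. Using
    [3 ^ m] in place of [3 ^ complexity m] keeps the formula primitive recursive without having to
    compute complexities. *)
Definition threshold m c := core_bound (3 ^ m) (scale (3 ^ m) (3 ^ m)) * c.

Lemma complexity_lower_bound m c k l : stable m -> 0 < c -> threshold m c <= k ->
  complexity m + 3 * k + 3 * l + 1 <= complexity ((m * 3 ^ k + c) * 3 ^ l).
Proof.
move=> [m_gt0 m_stable] c_gt0 le_k; set N := (_ + c) * _.
have N_gt0 : 0 < N by rewrite muln_gt0 expn_gt0 addn_gt0 c_gt0 orbT.
have [e [eV <-]] := complexity_expr N_gt0.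
rewrite addn1 ltnNge; apply/negP => le_e.
set A := 3 ^ m in le_k.
have A_gt0 : 0 < A by rewrite expn_gt0.
have lt_mA : m < A by rewrite ltn_expl.
have NE : N = m * 3 ^ (k + l) + c * 3 ^ l by rewrite /N mulnDl expnD mulnA.
have le_A : 3 ^ expr_ones e <= A * expr_val e ^ 3.
  apply: leq_trans (_ : 3 ^ (complexity m + 3 * (k + l)) <= _).
    by rewrite leq_exp2l //; lia.
  rewrite expnD leq_mul ?leq_exp2l ?complexity_le_id // mulnC expnM leq_exp2r // eV NE.
  by have : 0 < 3 ^ (k + l); [rewrite expn_gt0 | nia].
have [i lt_iA eq_cuts] := stationary_scale le_A.
set R := scale A i in eq_cuts; set R' := scale A i.+1 in eq_cuts.
have R_ge8 : 8 <= R by exact: scale_ge8.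
have R'_ge8 : 8 <= R' by exact: scale_ge8.
have le_RR' : R <= R' by exact: leq_scaleS.
have eq_pr : prune R' e = prune R e by apply: eq_prune => //; lia.
have [w [j [prE le_w]]] := prune_core_bound A_gt0 R_ge8 le_A.
have R'E : R' = A * (core_bound A R + A.+1) by [].
have lt_cuts := cuts_lt R'_ge8 le_A.
have lt_wc : w * c < 3 ^ k.
  apply: leq_ltn_trans (ltn_expl k (isT : 1 < 3)); apply: leq_trans le_k.
  rewrite /threshold leq_mul2r (leq_trans le_w) ?orbT //.
  by apply: core_bound_mono; apply: scale_mono => //; exact: ltnW.
have w_gt0 : 0 < w.
  by have := expr_val_gt0 (prune R e); rewrite prE muln_gt0 => /andP [].
have lt_c : c < 3 ^ k := leq_ltn_trans (leq_pmull c w_gt0) lt_wc.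
have := prune_val_ge R' e; have := prune_val_le R e.
rewrite eq_pr prE eV => le_prN ge_prN.
have j3_gt0 : 0 < 3 ^ j by rewrite expn_gt0.
have l3_gt0 : 0 < 3 ^ l by rewrite expn_gt0.
(* Without cuts, [N = w * 3 ^ j]. If [j <= l], then [w] is too large; if [j - l >= k], then [3 ^ k]
   divides [c]; in between, [3 ^ (j - l)] divides [c], so [m * 3 ^ k + c <= w * c < 3 ^ k]. *)
have [cuts0|cuts_gt0] := posnP (cuts R' e).
  have {ge_prN le_prN} NwE : N = w * 3 ^ j.
    apply/eqP; rewrite eqn_leq le_prN andbT.
    by move: ge_prN; rewrite cuts0 subn0 mulnC leq_pmul2l.
  have [le_jl|lt_lj] := leqP j l.
    have : m * 3 ^ k + c <= w.
      rewrite -(leq_pmul2r j3_gt0) -NwE /N leq_mul2l leq_exp2l // le_jl.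
      exact: orbT.
    by have := leq_pmull (3 ^ k) m_gt0; have := leq_pmulr w c_gt0; lia.
  have : m * 3 ^ k + c = w * 3 ^ (j - l).
    apply/eqP; rewrite -(eqn_pmul2r l3_gt0) -mulnA -expnD subnK ?(ltnW lt_lj) //.
    exact/eqP.
  have [le_kj|lt_jk] := leqP k (j - l) => NE'.
    have : 3 ^ k %| m * 3 ^ k + c by rewrite NE' dvdn_mull // dvdn_exp2l.
    by rewrite dvdn_addr ?dvdn_mull // => /dvdn_leq; lia.
  have : 3 ^ (j - l) %| m * 3 ^ k + c by rewrite NE' dvdn_mull.
  rewrite dvdn_addr ?dvdn_mull ?dvdn_exp2l ?(ltnW lt_jk) // => /(dvdn_leq c_gt0) le3c.
  have : m * 3 ^ k + c <= w * c by rewrite NE' leq_mul2l le3c orbT.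
  by have := leq_pmull (3 ^ k) m_gt0; lia.
have prQ : w * 3 ^ j = m * 3 ^ (k + l).
  (* A pruned value [p * d] below [q * d <= N] has lost at least the fraction [1 / (p + 1)] of [N],
     whereas fewer than [A] cuts at scale [R' >= A * p.+1] lose less. *)
  have far p q d : p <= core_bound A R \/ p <= A -> p < q -> q * d <= N ->
      N * (R'.+1 - cuts R' e) <= R'.+1 * (p * d) -> 0 < d -> False.
    move=> le_p lt_pq le_qd le_N d_gt0.
    have : p.+1 * d * (R'.+1 - cuts R' e) <= R'.+1 * (p * d).
      apply: leq_trans le_N; rewrite leq_mul2r; apply/orP; right.
      by apply: leq_trans le_qd; rewrite leq_mul2r lt_pq orbT.
    rewrite mulnAC mulnA leq_pmul2r //.
    have : R' >= A * p.+1 by rewrite R'E leq_mul2l; lia.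
    move: lt_cuts; move: (cuts R' e) => x; move: (R') => y lt_xA le_y.
    have le_xy : x * p.+1 <= y by apply: leq_trans le_y; rewrite leq_mul2r (ltnW lt_xA) orbT.
    rewrite -(subnKC le_xy); move: (y - _) => r.
    have -> : (x * p.+1 + r).+1 - x = x * p + r.+1 by lia.
    by lia.
  have kl3_gt0 : 0 < 3 ^ (k + l) by rewrite expn_gt0.
  have lt_cl : w * (c * 3 ^ l) < 3 ^ (k + l) by rewrite mulnA expnD ltn_pmul2r.
  (* The smaller of [3 ^ j] and [3 ^ (k + l)] is the common unit [d]. A deficit is excluded by
     [far]; an excess would be at least [d], yet at most [c * 3 ^ l], which is too small. *)
  have [le_j|lt_j] := leqP j (k + l).
    have QE : m * 3 ^ (k + l) = m * 3 ^ (k + l - j) * 3 ^ j.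
      by rewrite -mulnA -expnD subnK.
    rewrite QE; congr (_ * _); set q := m * 3 ^ (k + l - j) in QE *.
    case: (ltngtP w q) => [lt_wq|lt_qw|//].
      by case: (far w q (3 ^ j)) => //; [left | rewrite NE QE leq_addr].
    have le_jc : 3 ^ j <= c * 3 ^ l.
      rewrite -(leq_add2l (q * 3 ^ j)) -[in leqRHS]QE -NE; apply: leq_trans le_prN.
      by rewrite -mulSnr leq_mul2r lt_qw orbT.
    have : 3 ^ (k + l) <= w * 3 ^ j.
      by apply: leq_trans (_ : q * 3 ^ j <= _); [rewrite -QE leq_pmull | rewrite leq_mul2r ltnW ?orbT].
    by rewrite -(leq_pmul2l w_gt0) in le_jc; lia.
  have PE : w * 3 ^ j = w * 3 ^ (j - (k + l)) * 3 ^ (k + l).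
    by rewrite -mulnA -expnD subnK // ltnW.
  rewrite PE in le_prN ge_prN *; congr (_ * _); set p := w * 3 ^ (j - (k + l)) in PE le_prN ge_prN *.
  case: (ltngtP p m) => [lt_pm|lt_mp|//].
    by case: (far p m (3 ^ (k + l))) => //; [right; lia | rewrite NE leq_addr].
  have : 3 ^ (k + l) <= c * 3 ^ l.
    rewrite -(leq_add2l (m * 3 ^ (k + l))) -NE; apply: leq_trans le_prN.
    by rewrite -mulSnr leq_mul2r lt_mp orbT.
  by rewrite expnD leq_pmul2r // leqNgt lt_c.
(* By stability the pruned expression already uses all the allowed ones, and the cuts removed at
   least one more. *)
have := complexity_le (prune R e); rewrite prE prQ mulnC m_stable.
by have := prune_ones R e; rewrite -eq_cuts; lia.
Qed.

(** * The two complexity formulas *)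

Lemma complexity_succ_exp3 a : stable a -> forall k l, threshold a 1 <= k ->
  complexity ((a * 3 ^ k + 1) * 3 ^ l) = complexity a + 3 * k + 3 * l + 1.
Proof.
move=> a_st k l le_k; have [a_gt0 _] := a_st; apply/eqP.
rewrite eqn_leq (complexity_lower_bound l a_st (ltn0Sn 0) le_k) andbT.
have ak_gt0 : 0 < a * 3 ^ k by rewrite muln_gt0 a_gt0 expn_gt0.
have := complexity_mul_exp3 k a_gt0; have := complexity_succ ak_gt0.
by have := @complexity_mul_exp3 (a * 3 ^ k + 1) l; rewrite addn1 => /(_ isT); lia.
Qed.

Lemma complexity_mul_succ_exp3 a b : 0 < a -> 0 < b -> stable (a * b) ->
  complexity (a * b) = complexity a + complexity b ->
  forall k l, threshold (a * b) b <= k ->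
  complexity (b * (a * 3 ^ k + 1) * 3 ^ l) = complexity a + complexity b + 3 * k + 3 * l + 1.
Proof.
move=> a_gt0 b_gt0 ab_st ab_cplx k l le_k; apply/eqP; rewrite eqn_leq; apply/andP; split.
  have ak_gt0 : 0 < a * 3 ^ k by rewrite muln_gt0 a_gt0 expn_gt0.
  have ak1_gt0 : 0 < a * 3 ^ k + 1 by rewrite addn1.
  have bak_gt0 : 0 < b * (a * 3 ^ k + 1) by rewrite muln_gt0 b_gt0.
  have := complexity_mul_exp3 k a_gt0; have := complexity_succ ak_gt0.
  have := complexity_mul b_gt0 ak1_gt0; have := complexity_mul_exp3 l bak_gt0.
  by lia.
have := complexity_lower_bound l ab_st b_gt0 le_k; rewrite ab_cplx.
by have -> : b * (a * 3 ^ k + 1) = a * b * 3 ^ k + b by ring.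
Qed.

(** * Computability of the threshold *)

Definition computable n (f : n.-tuple nat -> nat) : Prop :=
  exists F : recfun n, forall v, computes F v (f v).

Lemma eq_computable n (f g : n.-tuple nat -> nat) : f =1 g -> computable f -> computable g.
Proof. by move=> fg [F FP]; exists F => v; rewrite -fg. Qed.

Lemma computable_proj n (i : 'I_n) : computable (fun v => tnth v i).
Proof. by exists (RProj i). Qed.

Lemma computable_comp m n (f : m.-tuple nat -> nat) (gs : 'I_m -> n.-tuple nat -> nat) :
  computable f -> (forall i, computable (gs i)) ->
  computable (fun v => f [tuple gs i v | i < m]).
Proof.
move=> [F FP] /choice [G GP]; exists (RComp F G) => v.
by exists [tuple gs i v | i < m] => // i; rewrite tnth_mktuple.
Qed.

Lemma computable_succ n (f : n.-tuple nat -> nat) :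
  computable f -> computable (fun v => (f v).+1).
Proof.
move=> fP; have S : computable (fun v : 1.-tuple nat => (thead v).+1) by exists RSucc.
by apply: eq_computable (computable_comp S (fun=> fP)) => v; rewrite /thead tnth_mktuple.
Qed.

Lemma computable_const n c : computable (fun _ : n.-tuple nat => c).
Proof. by elim: c => [|c IHc]; [exists (RZero n) | exact: computable_succ]. Qed.

Lemma computable_behead n (f : n.-tuple nat -> nat) :
  computable f -> computable (fun v : n.+1.-tuple nat => f [tuple of behead v]).
Proof.
move=> fP; apply: eq_computable (computable_comp fP (fun i => computable_proj (lift ord0 i))).
move=> v; congr f; apply: eq_from_tnth => i.
by rewrite tnth_mktuple [in LHS](tuple_eta v) tnthS.
Qed.

(** Primitive recursion with a step that ignores the counter suffices: sums, products, powers and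
    [scale] are all iterates. *)
Lemma computable_iter n (s : nat -> n.-tuple nat -> nat) (x0 k : n.-tuple nat -> nat) :
  computable (fun v : n.+1.-tuple nat => s (thead v) [tuple of behead v]) ->
  computable x0 -> computable k ->
  computable (fun v => iter (k v) (s^~ v) (x0 v)).
Proof.
move=> sP [F FP] kP.
have rP : computable (fun v : n.+1.-tuple nat =>
    iter (thead v) (s^~ [tuple of behead v]) (x0 [tuple of behead v])).
  have [G GP] := computable_behead sP.
  exists (RPrec F G) => v.
  exists (fun i => iter i (s^~ [tuple of behead v]) (x0 [tuple of behead v])).
  split=> // i _.
  have := GP [tuple of i :: iter i (s^~ [tuple of behead v]) (x0 [tuple of behead v]) :: behead v].
  by congr (computes _ _ (s _ _)); apply: val_inj.
(* [g] supplies the count [k v] as recursion argument, followed by [v] itself as parameters. *)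
pose g (i : 'I_n.+1) (v : n.-tuple nat) := if unlift ord0 i is Some j then tnth v j else k v.
have gP i : computable (g i).
  by rewrite /g; case: unliftP => [j _|_] //; exact: computable_proj.
apply: eq_computable (computable_comp rP gP) => v.
have -> : [tuple of behead [tuple g i v | i < n.+1]] = v.
  apply: eq_from_tnth => i.
  have := tnth_mktuple (g^~ v) (lift ord0 i).
  by rewrite [X in tnth X _](tuple_eta _) tnthS /g liftK.
by rewrite /thead tnth_mktuple /g unlift_none.
Qed.

Lemma computable_add n (f g : n.-tuple nat -> nat) :
  computable f -> computable g -> computable (fun v => f v + g v).
Proof.
move=> fP gP; have sP : computable (fun v : n.+1.-tuple nat => (thead v).+1).
  exact: computable_succ (computable_proj ord0).
by apply: eq_computable (computable_iter (s := fun r _ => r.+1) sP fP gP) => v; rewrite iter_succn.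
Qed.

Lemma computable_mul n (f g : n.-tuple nat -> nat) :
  computable f -> computable g -> computable (fun v => f v * g v).
Proof.
move=> fP gP.
have sP : computable (fun v : n.+1.-tuple nat => f [tuple of behead v] + thead v).
  exact: computable_add (computable_behead fP) (computable_proj ord0).
have := computable_iter (s := fun r v => f v + r) sP (computable_const n 0) gP.
by apply: eq_computable => v; rewrite iter_addn addn0.
Qed.

Lemma computable_exp n (f g : n.-tuple nat -> nat) :
  computable f -> computable g -> computable (fun v => f v ^ g v).
Proof.
move=> fP gP.
have sP : computable (fun v : n.+1.-tuple nat => f [tuple of behead v] * thead v).
  exact: computable_mul (computable_behead fP) (computable_proj ord0).
have := computable_iter (s := fun r v => f v * r) sP (computable_const n 1) gP.
by apply: eq_computable => v; rewrite iter_muln muln1.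
Qed.

Lemma computable_core_bound n (A R : n.-tuple nat -> nat) :
  computable A -> computable R -> computable (fun v => core_bound (A v) (R v)).
Proof.
move=> AP RP; apply: computable_exp (computable_mul (computable_const n 8) AP).
exact: computable_mul (computable_mul (computable_const n 4) AP) RP.
Qed.

Lemma computable_scale n (A k : n.-tuple nat -> nat) :
  computable A -> computable k -> computable (fun v => scale (A v) (k v)).
Proof.
move=> AP kP; have AbP := computable_behead AP; have RP := computable_proj (n := n.+1) ord0.
apply: (computable_iter (s := fun R v => A v * (core_bound (A v) R + (A v).+1))) => //.
  exact: computable_mul AbP (computable_add (computable_core_bound AbP RP) (computable_succ AbP)).
exact: computable_const.
Qed.

Lemma computable_threshold n (m c : n.-tuple nat -> nat) :
  computable m -> computable c -> computable (fun v => threshold (m v) (c v)).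
Proof.
move=> mP cP; have AP := computable_exp (computable_const n 3) mP.
exact: computable_mul (computable_core_bound AP (computable_scale AP AP)) cP.
Qed.

Theorem theorem1p4 :
  (exists F : recfun 1,
     forall a : nat, stable a ->
     exists K : nat, computes F [tuple a] K /\
       forall k l : nat, K <= k ->
         complexity ((a * 3 ^ k + 1) * 3 ^ l)
         = complexity a + 3 * k + 3 * l + 1)
  /\
  (exists G : recfun 2,
     forall a b : nat, 0 < a -> 0 < b -> stable (a * b) ->
     complexity (a * b) = complexity a + complexity b ->
     exists K : nat, computes G [tuple a; b] K /\
       forall k l : nat, K <= k ->
         complexity (b * (a * 3 ^ k + 1) * 3 ^ l)
         = complexity a + complexity b + 3 * k + 3 * l + 1).
Proof.
split.
  have [F FP] := computable_threshold (computable_proj ord0) (computable_const 1 1).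
  exists F => a a_st; exists (threshold a 1); split; first exact: FP [tuple a].
  exact: complexity_succ_exp3.
have aP : computable (fun v : 2.-tuple nat => tnth v ord0) := computable_proj ord0.
have bP : computable (fun v : 2.-tuple nat => tnth v ord_max) := computable_proj ord_max.
have [G GP] := computable_threshold (computable_mul aP bP) bP.
exists G => a b a_gt0 b_gt0 ab_st ab_cplx; exists (threshold (a * b) b).
split; first exact: GP [tuple a; b].
exact: complexity_mul_succ_exp3.
Qed.
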